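(* Let $A\in M_N(\mathbb{C})$, let $0<\epsilon<1$, and put $s=\dfrac{2\epsilon}{1-\epsilon}\|A\|$. If $\lambda\in\sigma_\epsilon(A)$, then $$\|A^k\|\geq |\lambda|^k-\frac{k\,s\,\|A\|^{k-1}}{1-ks/\|A\|}$$ for all $k$ such that $(2k+1)\epsilon<1$.
   Context: $M_N(\mathbb{C})$ is the algebra of complex $N\times N$ matrices, $\|\cdot\|$ denotes the norm on matrices (not further specified), $A^k$ is the $k$-th power of $A$, and for a complex number $z$, $z-A$ means $zI-A$ with $I$ the identity matrix. For $0<\epsilon<1$ the $\epsilon$-condition spectrum of $A$ is $$\sigma_\epsilon(A)=\left\{z\in\mathbb{C}: z-A \text{ is not invertible or } \|(z-A)^{-1}\|\,\|z-A\|\geq \frac{1}{\epsilon}\right\}.$$ *)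

(* Defs.v *)
From HB Require Import structures.
From mathcomp Require Import all_boot all_order all_algebra.
From mathcomp Require Import complex.
From mathcomp Require Import classical_sets reals.

Set Implicit Arguments.
Unset Strict Implicit.
Unset Printing Implicit Defensive.

Import Order.TTheory GRing.Theory Num.Theory.
Local Open Scope ring_scope.
Local Open Scope complex_scope.
Local Open Scope classical_set_scope.

(* The complex numbers are [R[i]] with [R : realType]. The library modulus
   [`|z|] is again an element of [R[i]]; [cmod z] is the same number in [R]. *)
Notation cmod := (@ComplexField.Normc.normc _).

(* A Banach algebra norm on M_N(C), N = n.+1 >= 1. Every operator norm induced
   by a vector norm on C^N (in particular the spectral norm) is of this kind.
   Neither submultiplicativity nor [matrix_norm1] follows from the vector space
   norm axioms, and both are used throughout the theory of condition spectra. *)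
Record is_matrix_norm (R : realType) (n : nat)
    (nrm : 'M[R[i]]_n.+1 -> R) : Prop := IsMatrixNorm {
  matrix_norm_eq0 : forall A, nrm A = 0 -> A = 0;
  matrix_normD : forall A B, nrm (A + B) <= nrm A + nrm B;
  matrix_normZ : forall (c : R[i]) A, nrm (c *: A) = cmod c * nrm A;
  matrix_normM : forall A B, nrm (A *m B) <= nrm A * nrm B;
  matrix_norm1 : nrm 1%:M = 1
}.

Definition condition_spectrum (R : realType) (n : nat)
    (nrm : 'M[R[i]]_n.+1 -> R) (eps : R) (A : 'M[R[i]]_n.+1) : set R[i] :=
  [set z : R[i] | z%:M - A \notin unitmx \/
                  eps^-1 <= nrm (invmx (z%:M - A)) * nrm (z%:M - A)].

(* Main.v *)
Require Import Defs.
From HB Require Import structures.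
From mathcomp Require Import all_boot all_order all_algebra.
From mathcomp Require Import complex.
From mathcomp Require Import classical_sets reals.
From mathcomp Require Import ring lra.

Set Implicit Arguments.
Unset Strict Implicit.
Unset Printing Implicit Defensive.

Import Order.TTheory GRing.Theory Num.Theory.
Local Open Scope ring_scope.
Local Open Scope complex_scope.

(** Put M = lambda - A, a = ||A|| and t = 2 eps / (1 - eps), so that s = t a.
    Telescoping gives lambda^k - A^k = M Q with Q = sum lambda^(k-1-i) A^i.
    If M is singular, a nonzero X with X M = 0 also kills lambda^k - A^k, and
    |lambda|^k <= ||A^k||. Otherwise M^-1 lambda^k = Q + M^-1 A^k, hence
    ||M^-1|| (|lambda|^k - ||A^k||) <= ||Q||. Membership in the condition
    spectrum yields first |lambda| <= (1 + t) a (the case k = 1) and then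
    1 <= s ||M^-1||, so that
      |lambda|^k - ||A^k|| <= s ||Q|| <= k s a^(k-1) (1 + t)^(k-1).
    Finally (1 + t)^k (1 - k t) <= (1 + t)^k (1 - t)^k <= 1 by Bernoulli's
    inequality, and 1 - k t > 0 is the hypothesis (2k + 1) eps < 1. *)

Lemma normc_ge0 (R : rcfType) (z : R[i]) : 0 <= cmod z.
Proof. by case: z => x y; rewrite sqrtr_ge0. Qed.

Lemma normcX (R : rcfType) (z : R[i]) k : cmod (z ^+ k) = cmod z ^+ k.
Proof.
elim: k => [|k IHk]; first by rewrite !expr0 ComplexField.Normc.normc1.
by rewrite !exprS ComplexField.Normc.normcM IHk.
Qed.

Lemma bernoulli_onem (R : realDomainType) (t : R) (k : nat) :
  0 <= t <= 1 -> 1 - k%:R * t <= (1 - t) ^+ k.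
Proof.
move=> /andP[t0 t1]; elim: k => [|k IHk]; first by rewrite expr0; lra.
have k0 : 0 <= k%:R :> R by [].
rewrite exprSr -natr1; apply: le_trans (ler_wpM2r _ IHk); first by nra.
by rewrite subr_ge0.
Qed.

Lemma expr1D_mul_onem_le1 (R : realDomainType) (t : R) (k : nat) :
  0 <= t -> k%:R * t <= 1 -> (1 + t) ^+ k.-1 * (1 - k%:R * t) <= 1.
Proof.
case: k => [|k] t0 kt1; first by rewrite expr0 mul0r subr0 mulr1.
have t1 : t <= 1.
  by apply: le_trans kt1; rewrite -[leLHS]mul1r ler_wpM2r// ler1n.
have p0 : 0 <= (1 + t) ^+ k by rewrite exprn_ge0// addr_ge0.
(* Raising the exponent of [1 + t >= 1] by one lets the powers pair up into
   [(1 - t ^+ 2) ^+ k.+1]. *)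
apply: (@le_trans _ _ ((1 + t) ^+ k.+1 * (1 - t) ^+ k.+1)).
  apply: ler_pM => //; first by rewrite subr_ge0.
    by rewrite exprS ler_peMl// lerDl.
  by apply: bernoulli_onem; rewrite t0 t1.
by rewrite -exprMn exprn_ile1//; nra.
Qed.

Lemma scalar_mxX (R : pzRingType) n (z : R) k :
  (z%:M : 'M_n.+1) ^+ k = (z ^+ k)%:M.
Proof.
elim: k => [|k IHk]; first by rewrite !expr0.
by rewrite !exprS IHk -mulmxE -scalar_mxM.
Qed.

(** The rows of [kermx M] span the left kernel; a square witness, unlike a row vector, has a norm
    under [nrm]. *)
Lemma singular_mulmx0 (F : fieldType) n (M : 'M[F]_n) :
  M \notin unitmx -> exists2 X : 'M[F]_n, X != 0 & X *m M = 0.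
Proof.
move=> Mu; exists (kermx M); last exact: mulmx_ker.
by rewrite kermx_eq0 row_free_unit.
Qed.

Section MatrixNorm.
Variables (R : realType) (n : nat) (nrm : 'M[R[i]]_n.+1 -> R).
Hypothesis Hnrm : is_matrix_norm nrm.
Implicit Types (A B X : 'M[R[i]]_n.+1) (z : R[i]).

Lemma nrm0 : nrm 0 = 0.
Proof.
by rewrite -(scale0r 0) (matrix_normZ Hnrm) ComplexField.Normc.normc0 mul0r.
Qed.

Lemma nrmN A : nrm (- A) = nrm A.
Proof.
rewrite -scaleN1r (matrix_normZ Hnrm) normcN.
by rewrite ComplexField.Normc.normc1 mul1r.
Qed.

Lemma nrm_ge0 A : 0 <= nrm A.
Proof. by have := matrix_normD Hnrm A (- A); rewrite subrr nrm0 nrmN; lra. Qed.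

Lemma nrm_gt0 A : A != 0 -> 0 < nrm A.
Proof.
move=> A0; rewrite lt_neqAle nrm_ge0 andbT eq_sym.
by apply: contraNneq A0 => /(matrix_norm_eq0 Hnrm)->.
Qed.

Lemma nrm_sum (I : Type) (r : seq I) (F : I -> 'M[R[i]]_n.+1) :
  nrm (\sum_(i <- r) F i) <= \sum_(i <- r) nrm (F i).
Proof.
elim/big_rec2: _ => [|i y B _ le_yB]; first by rewrite nrm0.
by apply: le_trans (matrix_normD Hnrm _ _) _; rewrite lerD2l.
Qed.

Lemma nrmX A k : nrm (A ^+ k) <= nrm A ^+ k.
Proof.
elim: k => [|k IHk]; first by rewrite !expr0 (matrix_norm1 Hnrm).
rewrite !exprS; apply: le_trans (matrix_normM Hnrm _ _) _.
by rewrite ler_wpM2l// nrm_ge0.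
Qed.

Lemma nrm_scalar z : nrm z%:M = cmod z.
Proof. by rewrite -scalemx1 (matrix_normZ Hnrm) (matrix_norm1 Hnrm) mulr1. Qed.

(** Triangle inequality for [z X = X (z - B) + X B]. It serves both for [X] annihilating [z - A] and
    for [X] the inverse of [z - A], with [B] a power of [A]. *)
Lemma nrm_mul_resolvent X B z :
  nrm X * (cmod z - nrm B) <= nrm (X *m (z%:M - B)).
Proof.
have := matrix_normD Hnrm (X *m (z%:M - B)) (X *m B).
rewrite -mulmxDr subrK mul_mx_scalar (matrix_normZ Hnrm).
by have := matrix_normM Hnrm X B; lra.
Qed.

Definition telescope_mx z A k : 'M[R[i]]_n.+1 :=
  \sum_(i < k) z%:M ^+ (k.-1 - i) * A ^+ i.

Lemma scalar_mxX_subX z A k :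
  (z ^+ k)%:M - A ^+ k = (z%:M - A) *m telescope_mx z A k.
Proof.
rewrite -scalar_mxX subrXX_comm//.
exact: comm_scalar_mx.
Qed.

Lemma nrm_telescope_mx z A k b : nrm A <= b -> cmod z <= b ->
  nrm (telescope_mx z A k) <= k%:R * b ^+ k.-1.
Proof.
move=> Ab zb; have b0 : 0 <= b := le_trans (nrm_ge0 A) Ab.
apply: le_trans (nrm_sum _ _) _.
rewrite mulr_natl -[X in _ *+ X]card_ord -sumr_const; apply: ler_sum => i _.
apply: le_trans (matrix_normM Hnrm _ _) _.
(* Since [i < k], the truncated subtraction is exact; for [k = 0] there is no index. *)
have <- : b ^+ (k.-1 - i) * b ^+ i = b ^+ k.-1.
  by rewrite -exprD subnK//; case: k i => [[]|k i] //; rewrite -ltnS.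
apply: ler_pM; rewrite ?nrm_ge0//.
  by rewrite scalar_mxX nrm_scalar normcX lerXn2r// nnegrE ?normc_ge0.
apply: le_trans (nrmX _ _) _.
by rewrite lerXn2r// nnegrE nrm_ge0.
Qed.

Lemma singular_normX_le z A k :
  z%:M - A \notin unitmx -> cmod z ^+ k <= nrm (A ^+ k).
Proof.
move=> /singular_mulmx0[X /nrm_gt0 X0 XM].
have := nrm_mul_resolvent X (A ^+ k) (z ^+ k).
rewrite scalar_mxX_subX mulmxA XM mul0mx nrm0 normcX.
by rewrite pmulr_rle0// subr_le0.
Qed.

Lemma nrm_resolventX z A k : z%:M - A \in unitmx ->
  nrm (invmx (z%:M - A)) * (cmod z ^+ k - nrm (A ^+ k))
    <= nrm (telescope_mx z A k).
Proof.
move=> Mu; have := nrm_mul_resolvent (invmx (z%:M - A)) (A ^+ k) (z ^+ k).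
by rewrite scalar_mxX_subX mulKmx// normcX.
Qed.

Lemma condition_spectrum_norm_le z A eps :
  0 < eps < 1 -> condition_spectrum nrm eps A z ->
  (1 - eps) * cmod z <= (1 + eps) * nrm A.
Proof.
move=> /andP[e0 e1] zA; have a0 := nrm_ge0 A.
(* Only [z] outside the disc of radius [nrm A] matters, and there [z - A] is invertible. *)
have [/= za|az] := leP (cmod z) (nrm A); first by nra.
case: zA => [/(singular_normX_le 1)|cond]; first by rewrite !expr1 leNgt az.
set M := z%:M - A in cond *.
have Mu : M \in unitmx.
  by apply: contraLR az => /(singular_normX_le 1); rewrite !expr1 -leNgt.
have := nrm_mul_resolvent (invmx M) A z.
rewrite mulVmx// (matrix_norm1 Hnrm) => inv_le.
have M_le : nrm M <= cmod z + nrm A.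
  by rewrite -nrm_scalar -(nrmN A) (matrix_normD Hnrm).
have e_cond : 1 <= eps * (nrm (invmx M) * nrm M).
  by rewrite -ler_pdivrMl// mulr1.
have := nrm_ge0 M; have := nrm_ge0 (invmx M).
set x := nrm (invmx M) in inv_le e_cond *; set m := nrm M in M_le e_cond *.
move=> x0 m0.
suff : cmod z - nrm A <= eps * m by nra.
have d0 : 0 <= cmod z - nrm A by rewrite subr_ge0 ltW.
(* Multiply by the factor from [e_cond], which is at least 1, then absorb
   [x * (cmod z - nrm A) <= 1]. *)
apply: (@le_trans _ _ ((cmod z - nrm A) * (eps * (x * m)))).
  by rewrite ler_peMr.
rewrite [leLHS](_ : _ = eps * m * (x * (cmod z - nrm A))); last by ring.
by rewrite ler_piMr// mulr_ge0// ltW.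
Qed.

Lemma condition_spectrum_normX_le z A eps t k :
  0 < eps < 1 -> t * (1 - eps) = 2 * eps -> condition_spectrum nrm eps A z ->
  cmod z ^+ k - nrm (A ^+ k)
    <= k%:R * (t * nrm A) * nrm A ^+ k.-1 * (1 + t) ^+ k.-1.
Proof.
move=> eps01 tE zA; have a0 := nrm_ge0 A.
have [e0 e1] := andP eps01.
have t0 : 0 <= t by nra.
(* Here [1 + t = (1 + eps) / (1 - eps)], so this is the previous lemma divided by [1 - eps]. *)
have z_le : cmod z <= nrm A * (1 + t).
  rewrite -(@ler_pM2l _ (1 - eps)) ?subr_gt0//.
  apply: le_trans (condition_spectrum_norm_le eps01 zA) _.
  have -> : (1 - eps) * (nrm A * (1 + t)) = (1 - eps + t * (1 - eps)) * nrm A.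
    by ring.
  by rewrite tE ler_wpM2r//; lra.
have rhs0 : 0 <= k%:R * (t * nrm A) * nrm A ^+ k.-1 * (1 + t) ^+ k.-1.
  by rewrite !mulr_ge0// exprn_ge0// addr_ge0.
(* A positive difference is the only case of substance, and it forces [z - A] to be invertible. *)
have [/= le0|gt0] := leP (cmod z ^+ k - nrm (A ^+ k)) 0.
  exact: le_trans le0 rhs0.
have Mu : z%:M - A \in unitmx.
  by apply: contraLR gt0 => /(singular_normX_le k); rewrite -leNgt subr_le0.
case: zA => [|cond]; first by rewrite Mu.
have := nrm_resolventX k Mu.
have b_le : nrm A <= nrm A * (1 + t) by nra.
have := nrm_telescope_mx k b_le z_le.
move: cond gt0; set M := z%:M - A; set d := _ - _; set q := nrm (telescope_mx _ _ _).
move=> cond d0 q_le dq.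
have x0 := nrm_ge0 (invmx M).
have s_ge : 1 <= nrm (invmx M) * (t * nrm A).
  have M_le : nrm M <= cmod z + nrm A.
    by rewrite -nrm_scalar -(nrmN A) (matrix_normD Hnrm).
  have : 1 <= eps * (nrm (invmx M) * nrm M) by rewrite -ler_pdivrMl// mulr1.
  move/le_trans; apply.
  rewrite mulrCA ler_wpM2l//.
  (* ||M|| <= (2 + t) a and eps (2 + t) = t *)
  apply: (@le_trans _ _ (eps * ((2 + t) * nrm A))); last first.
    by rewrite mulrA ler_wpM2r//; lra.
  by apply: ler_wpM2l; [exact: ltW | lra].
apply: (@le_trans _ _ (d * (nrm (invmx M) * (t * nrm A)))).
  by rewrite ler_peMr// ltW.
rewrite [leLHS](_ : _ = t * nrm A * (nrm (invmx M) * d)); last by ring.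
apply: (@le_trans _ _ (t * nrm A * (k%:R * (nrm A * (1 + t)) ^+ k.-1))).
  by rewrite ler_wpM2l ?mulr_ge0// (le_trans dq).
by rewrite exprMn !mulrA (mulrC _ k%:R) !mulrA.
Qed.

End MatrixNorm.

(* In Rocq [x / 0 = 0], so for [A = 0] the quotient s / ||A|| is read as 0;
   [k.-1] at [k = 0] is harmless because of the factor [k]. *)
Theorem mainTheorem5 (R : realType) (n : nat) (nrm : 'M[R[i]]_n.+1 -> R)
    (Hnrm : is_matrix_norm nrm) (A : 'M[R[i]]_n.+1) (eps : R)
    (Heps : 0 < eps < 1) (lambda : R[i]) :
  let s := 2 * eps / (1 - eps) * nrm A in
  condition_spectrum nrm eps A lambda ->
  forall k : nat, (2 * k + 1)%:R * eps < 1 ->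
    cmod lambda ^+ k
      - (k%:R * s * nrm A ^+ k.-1) / (1 - k%:R * s / nrm A)
    <= nrm (A ^+ k).
Proof.
move=> s lA k keps; have a0 := nrm_ge0 Hnrm A.
have [e0 e1] := andP Heps.
rewrite /s; set t := 2 * eps / (1 - eps).
have tE : t * (1 - eps) = 2 * eps by rewrite divfK// subr_eq0 gt_eqF.
rewrite lerBlDr -lerBlDl.
apply: le_trans (condition_spectrum_normX_le Hnrm k Heps tE lA) _.
(* If [nrm A = 0], both sides vanish through the factor [nrm A] in [s]. *)
have [->|aN0] := eqVneq (nrm A) 0; first by rewrite !(mulr0, mul0r).
have t0 : 0 <= t by rewrite divr_ge0// ?subr_ge0 ?mulr_ge0// ltW.
have -> : k%:R * (t * nrm A) / nrm A = k%:R * t by rewrite mulrA mulfK.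
(* The hypothesis on [k] reads [2 k eps < 1 - eps], that is [k t < 1]. *)
have kt1 : k%:R * t < 1.
  rewrite mulrA ltr_pdivrMr ?subr_gt0// mul1r.
  by move: keps; rewrite natrD natrM; lra.
(* Cancelling the common factor leaves [(1 + t) ^+ k.-1 <= (1 - k t)^-1]. *)
apply: ler_wpM2l; first by rewrite mulr_ge0 ?exprn_ge0// mulr_ge0// mulr_ge0.
rewrite -[leRHS]mul1r ler_pdivlMr ?subr_gt0//.
by rewrite expr1D_mul_onem_le1// ltW.
Qed.
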